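(* Let $A$ be a commutative ring, $\sigma$ a finite type hereditary torsion theory in the category of $A$-modules, and $M$ an $A$-module. The following statements are equivalent: (a) $M$ is totally $\sigma$-noetherian. (b) $M$ is totally $\sigma_{A\setminus\mathfrak{p}}$-noetherian for every $\mathfrak{p}\in\mathcal{C}(\sigma)=\mathrm{Max}\,\mathcal{K}(\sigma)$.
   Context: Rings are commutative with unit. A hereditary torsion theory $\sigma$ in the category of $A$-modules is given by its Gabriel filter $\mathcal{L}(\sigma)$: a non-empty filter of ideals of $A$ such that every ideal $\mathfrak{b}\subseteq A$ for which there exists $\mathfrak{a}\in\mathcal{L}(\sigma)$ with $(\mathfrak{b}:a)\in\mathcal{L}(\sigma)$ for every $a\in\mathfrak{a}$ belongs to $\mathcal{L}(\sigma)$. The theory $\sigma$ is of finite type if every ideal in $\mathcal{L}(\sigma)$ contains a finitely generated ideal belonging to $\mathcal{L}(\sigma)$. A module $M$ is totally $\sigma$-torsion if there exists $\mathfrak{h}\in\mathcal{L}(\sigma)$ with $M\mathfrak{h}=0$. A module $M$ is totally $\sigma$-finitely generated if there is a finitely generated submodule $M'\subseteq M$ such that $M/M'$ is totally $\sigma$-torsion (i.e. $M\mathfrak{h}\subseteq M'$ for some $\mathfrak{h}\in\mathcal{L}(\sigma)$). A module $M$ is totally $\sigma$-noetherian if every submodule of $M$ is totally $\sigma$-finitely generated. A module is $\sigma$-torsionfree if it has no nonzero element whose annihilator lies in $\mathcal{L}(\sigma)$. $\mathcal{K}(\sigma)$ is the set of prime ideals $\mathfrak{p}$ of $A$ such that $A/\mathfrak{p}$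 is $\sigma$-torsionfree (equivalently, $\mathfrak{p}\notin\mathcal{L}(\sigma)$), and $\mathcal{C}(\sigma)=\mathrm{Max}\,\mathcal{K}(\sigma)$ is the set of maximal elements of $\mathcal{K}(\sigma)$ under inclusion. For a prime ideal $\mathfrak{p}$, $\sigma_{A\setminus\mathfrak{p}}$ is the hereditary torsion theory with Gabriel filter $\{\mathfrak{a}\subseteq A\mid \mathfrak{a}\cap(A\setminus\mathfrak{p})\neq\varnothing\}$. *)

(* Defs.v *)
From mathcomp Require Import all_boot all_algebra.
From mathcomp Require Import boolp classical_sets functions cardinality.

Set Implicit Arguments.
Unset Strict Implicit.
Unset Printing Implicit Defensive.

Import GRing.Theory.

Local Open Scope classical_set_scope.
Local Open Scope ring_scope.

Section Modules.
Context {A : comPzRingType} {M : lmodType A}.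
Implicit Types (N G : set M) (x : M).

Definition is_submodule N : Prop := GRing.submod_closed [in N].

Definition generated G : set M := smallest is_submodule G.

Definition fin_generated N : Prop :=
  exists G, finite_set G /\ N = generated G.

(* (N : x), i.e. the annihilator of the class of x in M / N. *)
Definition colon N x : set A := [set a | N (a *: x)].

End Modules.

(* Ideals are the submodules of the regular module A^o. They need not be
   proper, unlike the ideals of ring_quotient, and the zero ring is allowed. *)
Definition is_ideal {A : comPzRingType} (I : set A) : Prop :=
  @is_submodule A A^o I.

Definition is_prime {A : comPzRingType} (p : set A) : Prop :=
  [/\ is_ideal p, ~ p 1 & forall a b : A, p (a * b) -> p a \/ p b].

(* A hereditary torsion theory is represented by its Gabriel filter L. *)
Record gabriel_filter {A : comPzRingType} (L : set (set A)) : Prop := {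
  gabriel_ideal : forall I, L I -> is_ideal I;
  gabriel_nonempty : L !=set0;
  gabriel_setI : forall I J, L I -> L J -> L (I `&` J);
  gabriel_up : forall I J, L I -> is_ideal J -> I `<=` J -> L J;
  gabriel_colon : forall b, is_ideal b ->
    (exists2 a, L a & forall x, a x -> L (@colon A A^o b x)) -> L b }.

Definition finite_type {A : comPzRingType} (L : set (set A)) : Prop :=
  forall I, L I -> exists2 J, L J & @fin_generated A A^o J /\ J `<=` I.

Section Torsion.
Context {A : comPzRingType} (L : set (set A)).

(* N / N' is totally torsion, for submodules N' `<=` N of M. *)
Definition totally_torsion_quot {M : lmodType A} (N N' : set M) : Prop :=
  exists2 h, L h & forall x a, N x -> h a -> N' (a *: x).

(* Stated for a submodule N of M, regarded as a module; its submodules are the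
   submodules of M contained in N. *)
Definition totally_fin_generated {M : lmodType A} (N : set M) : Prop :=
  exists N', [/\ fin_generated N', N' `<=` N & totally_torsion_quot N N'].

Definition totally_noetherian (M : lmodType A) : Prop :=
  forall N : set M, is_submodule N -> totally_fin_generated N.

(* M / N is torsionfree: the class of x is zero as soon as its annihilator
   (N : x) belongs to L. *)
Definition torsionfree_quot {M : lmodType A} (N : set M) : Prop :=
  forall x, L (colon N x) -> N x.

Definition Kset : set (set A) :=
  [set p | is_prime p /\ @torsionfree_quot A^o p].

Definition Cset : set (set A) :=
  [set p | Kset p /\ forall q, Kset q -> p `<=` q -> q = p].

End Torsion.

Definition prime_filter {A : comPzRingType} (p : set A) : set (set A) :=
  [set I | is_ideal I /\ I `&` ~` p !=set0].

Lemma prime_filter_gabriel {A : comPzRingType} (p : set A) :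
  is_prime p -> gabriel_filter (prime_filter p).
Proof.
move=> [_ p1 pM].
have idM (I : set A) (a x : A) : is_ideal I -> I x -> I (a * x).
  move=> [/set_mem I0 Ilin] Ix; apply/set_mem.
  by have := Ilin a x 0 (mem_set Ix) (mem_set I0); rewrite addr0.
split.
- by move=> I [].
- exists setT; split; last by exists 1.
  by split=> [|a u v _ _]; apply/mem_set.
- move=> I J [Iid [s [Is ps]]] [Jid [t [Jt pt]]]; split.
    have [/set_mem I0 Ilin] := Iid; have [/set_mem J0 Jlin] := Jid.
    split; first by apply/mem_set.
    move=> a u v /set_mem[Iu Ju] /set_mem[Iv Jv]; apply/mem_set; split.
      by apply/set_mem/Ilin; apply/mem_set.
    by apply/set_mem/Jlin; apply/mem_set.
  exists (s * t); split; last by case/pM.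
  by split; [rewrite mulrC; exact: idM | exact: idM].
- by move=> I J [_ [s [Is ps]]] Jid IJ; split=> //; exists s; split=> //; apply: IJ.
- move=> b bid [a [_ [s [as_ ps]]] /(_ s as_)[_ [t [bts pt]]]]; split=> //.
  by exists (t * s); split=> //; case/pM.
Qed.

(* Main.v *)
Require Import Defs.
From mathcomp Require Import all_boot all_algebra.
From mathcomp Require Import boolp classical_sets functions cardinality.

(** For a submodule N, the scalars s with s N contained in a finitely generated
    submodule of N form an ideal. Under (b) this ideal is contained in no
    element of C(sigma); since sigma has finite type, Zorn's lemma puts every
    ideal outside L(sigma) below an element of C(sigma), so the ideal belongs
    to L(sigma). A finitely generated ideal of L(sigma) inside it then involves
    only finitely many of these submodules, and their sum works for N.
    Conversely, no ideal of L(sigma) is contained in an element of K(sigma). *)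

Set Implicit Arguments.
Unset Strict Implicit.
Unset Printing Implicit Defensive.

Import GRing.Theory.

Local Open Scope classical_set_scope.
Local Open Scope ring_scope.

(** By induction on a list of the elements of [G]: of two members of the chain, one holding the tail
    and one the head, the larger holds both. This pushes a finitely generated ideal below the union
    of a chain into a single member. *)
Lemma finite_subset_chain (T : choiceType) (F : set (set T)) (G : set T) :
  F !=set0 -> total_on F subset -> finite_set G ->
  G `<=` \bigcup_(X in F) X -> exists2 X, F X & G `<=` X.
Proof.
move=> [X0 FX0] totF /finite_seqP[s ->]; elim: s => [_|x s IHs sF].
  by exists X0.
have [|X FX sX] := IHs.
  by move=> y /= ys; apply: sF; rewrite /= inE ys orbT.
have [|Y FY xY] := sF x; first by rewrite /= inE eqxx.
have [XY|YX] := totF X Y FX FY; [exists Y => // | exists X => //].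
  by move=> y /=; rewrite inE => /predU1P[->//|/sX/XY].
by move=> y /=; rewrite inE => /predU1P[->|/sX//]; apply: YX.
Qed.

Lemma is_submoduleP (A : comPzRingType) (M : lmodType A) (N : set M) :
  is_submodule N <->
  N 0 /\ forall a u v, N u -> N v -> N (a *: u + v).
Proof.
split=> [[/set_mem N0 Nlin]|[N0 Nlin]]; split.
- by [].
- by move=> a u v Nu Nv; apply/set_mem/Nlin; exact: mem_set.
- exact: mem_set.
- by move=> a u v /set_mem Nu /set_mem Nv; exact/mem_set/Nlin.
Qed.

Lemma is_idealP (A : comPzRingType) (I : set A) :
  is_ideal I <-> I 0 /\ forall a u v, I u -> I v -> I (a * u + v).
Proof. exact: (@is_submoduleP A A^o). Qed.

Section Submodules.
Context {A : comPzRingType} {M : lmodType A}.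
Implicit Types (N G : set M) (x u v : M) (a s : A).

Lemma submodule0 N : is_submodule N -> N 0.
Proof. by case/is_submoduleP. Qed.

Lemma submoduleZ N a u : is_submodule N -> N u -> N (a *: u).
Proof.
by case/is_submoduleP=> N0 Nlin Nu; rewrite -[_ *: _]addr0; exact: Nlin.
Qed.

Lemma submoduleD N u v : is_submodule N -> N u -> N v -> N (u + v).
Proof.
by case/is_submoduleP=> _ Nlin Nu Nv; rewrite -[u]scale1r; exact: Nlin.
Qed.

Lemma submodule_generated G : is_submodule (generated G).
Proof.
apply/is_submoduleP; split=> [N [/submodule0]//|a u v Gu Gv N [Nsub GN]].
by apply: submoduleD; [|apply: submoduleZ|]; [..|apply: Gu|apply: Gv].
Qed.

Lemma generated_sub G N : is_submodule N -> G `<=` N -> generated G `<=` N.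
Proof. exact: smallest_sub. Qed.

Lemma sub_generated G : G `<=` generated G.
Proof. exact: sub_gen_smallest. Qed.

Lemma generatedS G1 G2 : G1 `<=` G2 -> generated G1 `<=` generated G2.
Proof. by apply: sub_smallest2r; exact: submodule_generated. Qed.

Lemma ideal_colon N x : is_submodule N -> is_ideal (colon N x).
Proof.
move=> Nsub; apply/is_idealP; split=> [|a s t Ns Nt] /=.
  by rewrite /colon /= scale0r; exact: submodule0.
rewrite /colon /= scalerDl -scalerA.
by apply: submoduleD => //; exact: submoduleZ.
Qed.

Lemma ideal_transporter N N' :
  is_submodule N' -> is_ideal [set s | forall x, N x -> N' (s *: x)].
Proof.
move=> N'sub; apply/is_idealP; split=> [x Nx|a s t Ns Nt x Nx] /=.
  by rewrite scale0r; exact: submodule0.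
rewrite scalerDl -scalerA.
by apply: submoduleD; [|apply: submoduleZ => //; exact: Ns|exact: Nt].
Qed.

(** The union of the ideals [(N' : N)] over all finitely generated submodules [N'] of [N]. *)
Definition fg_multiplier N : set A :=
  [set s | exists G, [/\ finite_set G, generated G `<=` N &
                         forall x, N x -> generated G (s *: x)]].

Lemma ideal_fg_multiplier N : is_submodule N -> is_ideal (fg_multiplier N).
Proof.
move=> Nsub; apply/is_idealP; split=> [|a s t].
  exists set0; split=> //; first exact: generated_sub.
  by move=> x _; rewrite scale0r; exact: submodule0 (submodule_generated _).
(* Pooling the generators gives one submodule that works for both [s] and [t]. *)
move=> [G [finG GN sG]] [H [finH HN tH]]; exists (G `|` H); split.
- by rewrite finite_setU.
- by apply: generated_sub => // x [/sub_generated/GN|/sub_generated/HN].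
- move=> x Nx; rewrite scalerDl -scalerA.
  apply: (submoduleD (submodule_generated _)).
    apply: (submoduleZ _ (submodule_generated _)).
    by apply: generatedS (sG x Nx) => y; left.
  by apply: generatedS (tH x Nx) => y; right.
Qed.

End Submodules.

Lemma totally_fin_generatedP (A : comPzRingType) (M : lmodType A)
    (L : set (set A)) (N : set M) :
  gabriel_filter L -> finite_type L -> is_submodule N ->
  totally_fin_generated L N <-> L (fg_multiplier N).
Proof.
move=> gL finL Nsub; split=> [[_ [[G [finG ->]] GN [h Lh hN]]]|LI].
  apply: (gabriel_up gL Lh); first exact: ideal_fg_multiplier.
  by move=> s hs; exists G; split=> // x Nx; exact: hN.
have [J LJ [[S [finS JS]] JI]] := finL _ LI.
have SI s : S s -> fg_multiplier N s
  by move=> Ss; apply: JI; rewrite JS; exact: (@sub_generated _ A^o).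
have [G GP] : {G : A -> set M & forall s, S s -> [/\ finite_set (G s),
    generated (G s) `<=` N & forall x, N x -> generated (G s) (s *: x)]}.
  apply: (@choice _ _ (fun s G => S s -> [/\ finite_set G,
    generated G `<=` N & forall x, N x -> generated G (s *: x)])) => s.
  (* Outside [S] the value [set0] is a dummy. *)
  by have [/SI[G ?]|nSs] := pselect (S s); [exists G | exists set0].
exists (generated (\bigcup_(s in S) G s)); split.
- exists (\bigcup_(s in S) G s); split=> //.
  by apply: bigcup_finite => // s /GP[].
- by apply: generated_sub => // x [s /GP[_ GN _] /sub_generated/GN].
(* The scalars carrying [N] into this submodule form an ideal, so it suffices to test the generators
   of [J]. *)
- exists J => // x a Nx Ja; move: a Ja x Nx.
  rewrite JS; apply: (@generated_sub _ A^o).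
    exact: ideal_transporter (submodule_generated _).
  move=> s Ss x Nx; have [_ _ /(_ x Nx)] := GP s Ss.
  by apply: generatedS => y Gy; exists s.
Qed.

(** * Ideals maximal outside the Gabriel filter *)

Section Ideals.
Context {A : comPzRingType} (L : set (set A)).
Implicit Types (I J p : set A).

(** The class of 1 in [A / p] has annihilator [p], so [L p] would force it to vanish. *)
Lemma prime_torsionfree_notin p :
  is_prime p -> @torsionfree_quot A L A^o p -> ~ L p.
Proof.
move=> [_ p1 _] tf Lp; apply/p1/tf.
rewrite (_ : colon _ _ = p)//.
by apply/seteqP; split=> a; rewrite /colon /= [_ *: _]mulr1.
Qed.

Lemma ideal_bigcup_chain (F : set (set A)) :
  F !=set0 -> total_on F subset -> (forall I, F I -> is_ideal I) ->
  is_ideal (\bigcup_(I in F) I).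
Proof.
move=> [I0 FI0] totF Fid; apply/is_idealP; split=> [|a u v [I FI Iu] [J FJ Jv]].
  by exists I0 => //; exact: submodule0 (Fid _ FI0).
have [IJ|JI] := totF I J FI FJ; [exists J => // | exists I => //];
  have [_ Ilin] := (is_idealP _).1 (Fid _ FI);
  have [_ Jlin] := (is_idealP _).1 (Fid _ FJ).
- by apply: Jlin => //; exact: IJ.
- by apply: Ilin => //; exact: JI.
Qed.

Hypotheses (gL : gabriel_filter L) (finL : finite_type L).

Lemma exists_maximal_notin I : is_ideal I -> ~ L I ->
  exists p, [/\ is_ideal p, ~ L p, I `<=` p &
    forall q, is_ideal q -> p `<=` q -> ~ L q -> q = p].
Proof.
move=> Iid nLI.
(* Zorn_bigcup also tests the empty chain, hence the union with I. *)
pose P : set (set A) := [set X | is_ideal (I `|` X) /\ ~ L (I `|` X)].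
have [F FP totF|X [[pid nLp] Xmax]] := @Zorn_bigcup _ P.
  have [->|F0] := eqVneq F set0; first by rewrite bigcup_set0 /P /= setU0.
  have {}F0 : F !=set0 by exact/set0P.
  pose F' := [set I `|` X | X in F].
  have F'E : I `|` \bigcup_(X in F) X = \bigcup_(X in F') X.
    rewrite bigcup_image.
    apply/seteqP; split=> [a [Ia|[X FX Xa]]|a [X FX [Ia|Xa]]].
    - by have [X FX] := F0; exists X => //; left.
    - by exists X => //; right.
    - by left.
    - by right; exists X.
  have F'0 : F' !=set0 by have [X FX] := F0; exists (I `|` X); exists X.
  have totF' : total_on F' subset.
    move=> _ _ [X FX <-] [Y FY <-].
    by have [XY|YX] := totF X Y FX FY; [left|right]; exact: setUS.
  have F'id J : F' J -> is_ideal J by case=> X /FP[? _] <-.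
  rewrite /P /= F'E; split; first exact: ideal_bigcup_chain.
  (* If the union were in [L], finite type would give a finitely generated [J] in [L] below it; [J]
     sits in one member of the chain, which would then be in [L] too. *)
  move=> /finL[J LJ [[G [finG JG]] JF]].
  have [|_ [X FX <-] GX] := finite_subset_chain F'0 totF' finG.
    by move=> x Gx; apply: JF; rewrite JG; exact: (@sub_generated _ A^o).
  have [Xid nLX] := FP X FX; apply/nLX/(gabriel_up gL LJ Xid).
  by rewrite JG; exact: (@generated_sub _ A^o).
exists (I `|` X); split=> // q qid pq nLq.
apply/seteqP; split=> //; apply: contrapT => nqp.
have [Iq Xq] : I `<=` q /\ X `<=` q by split=> x ?; apply: pq; [left|right].
(* As [q] contains [I], it is itself a candidate; not being inside [I]|[X], it would strictly exceed
   [X]. *)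
apply: (Xmax q); last by rewrite /P /= (setUidPr _ _).2.
by split=> // qX; apply: nqp => x /qX; right.
Qed.

Lemma maximal_notin_Cset p :
  is_ideal p -> ~ L p ->
  (forall q, is_ideal q -> p `<=` q -> ~ L q -> q = p) -> Cset L p.
Proof.
move=> pid nLp pmax.
(* q / p is the torsion submodule of A / p: if q were larger than p, it would be
   in L by maximality, and then so would p. *)
pose q : set A := [set x | L (@colon A A^o p x)].
have colonid x : is_ideal (@colon A A^o p x) by exact: ideal_colon.
have p_colon x : p `<=` @colon A A^o p x.
  by move=> y py; rewrite /colon /= [_ *: _]mulrC; exact: (submoduleZ x pid).
have LT : L setT.
  have [I LI] := gabriel_nonempty gL; apply: (gabriel_up gL LI) => //.
  by apply/is_idealP.
have pq : p `<=` q.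
  move=> x px; rewrite /q /= (_ : colon _ _ = setT)//.
  by apply/seteqP; split=> // a _; exact: (submoduleZ a pid).
have qid : is_ideal q.
  apply/is_idealP; split=> [|a x y qx qy]; first exact/pq/(submodule0 pid).
  (* [(p : a x + y)] contains the intersection of [(p : x)] and [(p : y)]. *)
  apply: (gabriel_up gL (gabriel_setI gL qx qy) (colonid _)) => b [px py].
  rewrite /colon /= scalerDr scalerA mulrC -scalerA.
  by apply: (submoduleD pid) => //; exact: (submoduleZ a pid).
have nLq : ~ L q.
  by move=> Lq; apply/nLp/(gabriel_colon gL pid); exists q.
have tf : @torsionfree_quot A L A^o p by move=> x qx; rewrite -(pmax q).
have pprime : is_prime p.
  split=> // [p1|a b pab].
    apply: nLp; rewrite (_ : p = setT)//; apply/seteqP; split=> // a _.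
    by rewrite -[a]mulr1; exact: (submoduleZ a pid).
  have [pa|npa] := pselect (p a); [by left|right].
  (* [(p : b)] contains both [p] and [a]; outside [L] it would equal [p] by maximality, so [a] would
     be in [p]. *)
  apply: tf; apply: contrapT => nLb; apply: npa.
  by rewrite -(pmax _ (colonid b) (@p_colon b) nLb).
split=> // r [rprime rtf] pr; apply: pmax => //; first by case: rprime.
exact: prime_torsionfree_notin.
Qed.

End Ideals.

Theorem proposition2 (A : comPzRingType) (L : set (set A))
    (gabrielL : gabriel_filter L) (finL : finite_type L) (M : lmodType A) :
  totally_noetherian L M <->
  (forall p : set A, Cset L p -> totally_noetherian (prime_filter p) M).
Proof.
split=> [noeth p [[pprime ptf] _] N Nsub|noeth N Nsub].
  have [N' [fgN' N'N [h Lh hN]]] := noeth N Nsub.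
  (* The same [N'] and [h] serve once [h] is known to meet the complement of [p]; otherwise [h] is
     inside [p], which puts [p] in [L]. *)
  exists N'; split=> //; exists h => //; have hid := gabriel_ideal gabrielL Lh.
  split=> //; apply: contrapT => /nonemptyPn hp.
  apply: (prime_torsionfree_notin pprime ptf).
  have [pid _ _] := pprime.
  apply: (gabriel_up gabrielL Lh pid).
  by apply/subsets_disjoint.
apply/(totally_fin_generatedP gabrielL finL Nsub); apply: contrapT => nLI.
have [p [pid nLp Ip pmax]] :=
  exists_maximal_notin gabrielL finL (ideal_fg_multiplier Nsub) nLI.
have [_ [[G [finG ->]] GN [h [_ [s [hs nps]]] hN]]] :=
  noeth p (maximal_notin_Cset gabrielL pid nLp pmax) N Nsub.
(* The scalar [s] outside [p] is a multiplier of [N], hence in [p] by [Ip]. *)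
by apply/nps/Ip; exists G; split=> // x Nx; exact: hN.
Qed.
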